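(* Let $C$ be an $n\times n$ generalized conference matrix with minimal polynomial $z^2-\beta z-(n-1)$, and let $t\in\mathbb{C}\setminus\{0\}$. If $t+t^{-1}+\beta=0$, then $tI+C$ is a type-II matrix.
   Context: An $n\times n$ matrix $C$ is a generalized conference matrix if $C$ is Hermitian, $C_{i,i}=0$ for all $i$, $|C_{i,j}|=1$ for $i\neq j$, and the minimal polynomial of $C$ is quadratic. For a matrix $W$ with all entries non-zero, $W^{(-)}$ denotes its entrywise inverse; an $n\times n$ such matrix is type-II if $W(W^{(-)})^T=nI$. *)

(* Defs.v *)
From mathcomp Require Import all_boot all_order all_algebra.
From mathcomp Require Import complex.
From mathcomp Require Import reals.

Set Implicit Arguments.
Unset Strict Implicit.
Unset Printing Implicit Defensive.

Import Order.TTheory GRing.Theory Num.Theory.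
Local Open Scope ring_scope.

(* mxminpoly is only available for matrices of order n.+1; the order-0 matrix
   has minimal polynomial 1, so it is not a generalized conference matrix. *)
Definition generalized_conference (K : numClosedFieldType) (n : nat)
    (C : 'M[K]_n.+1) : Prop :=
  [/\ C \is hermsymmx,
      forall i, C i i = 0,
      forall i j, i != j -> `|C i j| = 1 &
      size (mxminpoly C) = 3%N].

Definition entry_inv (F : fieldType) (m n : nat) (W : 'M[F]_(m, n)) :
    'M[F]_(m, n) :=
  map_mx GRing.inv W.

Definition typeII (F : fieldType) (n : nat) (W : 'M[F]_n) : Prop :=
  (forall i j, W i j != 0) /\ W *m (entry_inv W)^T = n%:R%:M.

(* Main.v *)
(** Since the off-diagonal entries of [C] are unimodular and [C] is Hermitian,
    the transpose of the entrywise inverse of [tI + C] is [t^-1 I + C]. The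
    product [(tI + C)(t^-1 I + C) = I + (t + t^-1) C + C^2] then equals
    [I - beta C + C^2], which is [nI] because [C] is a root of its minimal
    polynomial. *)
Require Import Defs.
From mathcomp Require Import all_boot all_order all_algebra.
From mathcomp Require Import complex.
From mathcomp Require Import reals.
Import Order.TTheory GRing.Theory Num.Theory.
Local Open Scope ring_scope.

Lemma unit_norm_invC (K : numClosedFieldType) (x : K) :
  `|x| = 1 -> x^-1 = Num.conj x.
Proof. by move=> x1; rewrite invC_norm x1 expr1n invr1 mul1r. Qed.

Lemma hermsymmx_entry (K : numClosedFieldType) (n : nat) (C : 'M[K]_n) i j :
  C \is hermsymmx -> C i j = Num.conj (C j i).
Proof.
by move/is_hermitianmxP => {1}->; rewrite expr0 scale1r !mxE.
Qed.

(** Off the diagonal, inversion is conjugation, which the transpose undoes; at [t = 0] the diagonals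
    still agree, since [0^-1 = 0]. *)
Lemma trmx_entry_inv_shift (K : numClosedFieldType) (n : nat) (C : 'M[K]_n)
    (t : K) :
  C \is hermsymmx -> (forall i, C i i = 0) ->
  (forall i j, i != j -> `|C i j| = 1) ->
  (entry_inv (t%:M + C))^T = t^-1%:M + C.
Proof.
move=> herC diagC normC; apply/matrixP=> i j; rewrite !mxE.
have [->|neq_ij] := eqVneq i j; first by rewrite !mulr1n diagC !addr0.
rewrite !mulr0n !add0r unit_norm_invC.
  by rewrite -hermsymmx_entry.
by rewrite normC // eq_sym.
Qed.

(** Evaluating the minimal polynomial at [C] gives zero. *)
Lemma sqr_mxminpoly_quadratic (F : fieldType) (n : nat) (C : 'M[F]_n.+1)
    (b c : F) :
  mxminpoly C = 'X^2 - b *: 'X - c%:P -> C *m C = b *: C + c%:M.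
Proof.
move=> minC; have := mx_root_minpoly C.
rewrite minC !rmorphB /= linearZ /= rmorphXn /= horner_mx_X horner_mx_C expr2.
by move/eqP; rewrite -addrA -opprD subr_eq0 => /eqP.
Qed.

Theorem theorem7p3 (R : realType) (n : nat) (C : 'M[R[i]]_n.+1)
  (beta t : R[i])
  (hC : generalized_conference C)
  (hmin : mxminpoly C = 'X^2 - beta *: 'X - (n.+1%:R - 1)%:P)
  (ht : t != 0)
  (htb : t + t^-1 + beta = 0) :
  typeII (t%:M + C).
Proof.
have [herC diagC normC _] := hC; split=> [i j|].
  rewrite !mxE; have [->|neq_ij] := eqVneq i j.
    by rewrite mulr1n diagC addr0.
  by rewrite mulr0n add0r -normr_eq0 normC // oner_eq0.
rewrite trmx_entry_inv_shift // mulmxDl !mulmxDr !mul_mx_scalar.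
rewrite mul_scalar_mx scale_scalar_mx mulVf //.
(* The multiples [t], [t^-1] and [beta] of [C] are gathered and cancel by [htb]; the scalar parts
   [1] and [n.+1%:R - 1] remain. *)
rewrite (sqr_mxminpoly_quadratic _ _ _ _ _ hmin) addrA -(addrA _ (t *: C)) -scalerDl.
rewrite addrA -(addrA _ ((t + _) *: C)) -scalerDl htb scale0r addr0.
by rewrite -raddfD /= addrC subrK.
Qed.
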